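(* Suppose that $\mathbb{E}(Y^2)<+\infty$ and $\mathbb{E}(\|\mathbf X\|^2)<+\infty$, that $(\boldsymbol\beta,\sigma_\epsilon^2)\in\Theta$ where $\Theta\subset\mathbb{R}^{d+1}\times[0,\infty)$ is a compact set that does not contain $0$, that the linear model $Y=\beta_0+\sum_{j=1}^d\beta_jX_j+\epsilon$ holds, and that $\operatorname{rank}(\boldsymbol\mu_{1,X})=d+1$. Then the sequence of estimators $(\widehat{\boldsymbol\beta}^W,\widehat\sigma_\epsilon^{2,W})$ minimizing $\varphi_n$ over $\Theta$ converges in probability to $(\boldsymbol\beta,\sigma_\epsilon^2)$ when $n_{\min}$ tends to infinity.
   Context: Setting. $Y$ is a real random variable, $\mathbf X=(X_1,\dots,X_d)$ a random vector in $\mathbb{R}^d$, $G$ a categorical variable with values in $\{1,\dots,K\}$ and $\mathbb{P}[G=k]>0$ for all $k$, with $Y=\beta_0+\sum_{j=1}^d\beta_jX_j+\epsilon$, where $\epsilon$ is independent of $(\mathbf X,G)$, has mean zero and variance $\sigma_\epsilon^2$, and $\boldsymbol\beta=(\beta_0,\dots,\beta_d)^\top$. Put $\boldsymbol\mu_X^k=\mathbb{E}(\mathbf X\mid G=k)\in\mathbb{R}^d$, and let $\boldsymbol\mu_{1,X}$ be the $K\times(d+1)$ matrix with $k$th row $(1,\boldsymbol\mu_X^{k\top})$. For $\boldsymbol\gamma=(\gamma_0,\dots,\gamma_d)$ write $\boldsymbol\gamma_{-0}=(\gamma_1,\dots,\gamma_d)^\top$. Data. $\mathbf X$ and $Y$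 are never observed jointly. $K$ is fixed. For each $k$ there are an i.i.d. sample $Y_1^k,\dots,Y_{n_y^k}^k$ from the conditional law of $Y$ given $G=k$ and an i.i.d. sample $\mathbf X_1^k,\dots,\mathbf X_{n_x^k}^k$ from the conditional law of $\mathbf X$ given $G=k$; these $2K$ samples are mutually independent. $n_{\min}=\min(n_y^1,\dots,n_y^K,n_x^1,\dots,n_x^K)$. Estimator. $\widehat\mu_Y^k=\frac1{n_y^k}\sum_iY_i^k$, $\widehat{\boldsymbol\mu}_X^k=\frac1{n_x^k}\sum_i\mathbf X_i^k$, $\widehat\sigma_{Y,k}^2=\frac1{n_y^k}\sum_i(Y_i^k)^2-(\widehat\mu_Y^k)^2$, $\widehat{\boldsymbol\Gamma}_X^k=\frac1{n_x^k}\sum_i\mathbf X_i^k(\mathbf X_i^k)^\top-\widehat{\boldsymbol\mu}_X^k(\widehat{\boldsymbol\mu}_X^k)^\top$. With fixed weights $\pi_k>0$, $\sum_k\pi_k=1$ ($\pi_k=\mathbb{P}[G=k]$, or $\pi_k=1/K$ in the absence of prior information), the optimal transport (minimum Wasserstein distance) estimator $(\widehat{\boldsymbol\beta}^W,\widehat\sigma_\epsilon^{2,W})$ is a (measurable) minimizer over $(\boldsymbol\gamma,\sigma^2)\in\Theta$ of $$\varphi_n(\boldsymbol\gamma,\sigma^2)=\sum_{k=1}^K\pi_k\left[(\widehat\mu_Y^k-\gamma_0-\boldsymbol\gamma_{-0}^\top\widehat{\boldsymbol\mu}_X^k)^2+\left(\widehat\sigma_{Y,k}-\sqrt{\boldsymbol\gamma_{-0}^\top\widehat{\boldsymbol\Gamma}_X^k\boldsymbol\gamma_{-0}+\sigma^2}\right)^2\right].$$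 *)

(* Defs.v *)
From HB Require Import structures.
From mathcomp Require Import all_boot all_order all_algebra.
From mathcomp Require Import all_classical all_reals all_analysis.

Set Implicit Arguments.
Unset Strict Implicit.
Unset Printing Implicit Defensive.

Import Order.TTheory GRing.Theory Num.Theory.
Import numFieldNormedType.Exports.

Local Open Scope classical_set_scope.
Local Open Scope ring_scope.

Section independence.
Context d (T : measurableType d) (R : realType) (P : probability T R).

Definition indep_systems (F1 F2 : set_system T) : Prop :=
  forall A B, F1 A -> F2 B -> P (A `&` B) = (P A * P B)%E.

(* Finite families only, which is all that finite samples require; the product
   rule is demanded for every subfamily. *)
Definition mutual_indep (I : finType) (F : I -> set_system T) : Prop :=
  forall (J : {set I}) (E : I -> set T), (forall i, i \in J -> F i (E i)) ->
    P (\bigcap_(i in [set` J]) E i) = (\prod_(i in J) P (E i))%E.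

(* P(A | B) and E(f | B), meaningful for P(B) > 0. *)
Definition cond_prob (B A : set T) : \bar R := (P (A `&` B) / P B)%E.

Definition cond_expect (B : set T) (f : T -> R) : R :=
  (\int[P]_(w in B) f w) / fine (P B).

End independence.

Definition sigma_of d (T : Type) (T' : measurableType d) (f : T -> T') :
  set_system T := preimage_set_system setT f measurable.

(* sigma(X, G) for a categorical G; 'I_K carries the discrete sigma-algebra but
   is not a measurableType because it may be empty. *)
Definition sigma_pair d (T : Type) (T' : measurableType d) (K : nat)
    (X : T -> T') (G : T -> 'I_K) : set_system T :=
  <<s sigma_of X `|` preimage_set_system setT G discrete_measurable >>.

Definition iid_sample d (T : measurableType d) (R : realType)
    (Q : probability T R) d' (T' : measurableType d') (n : nat)
    (S : 'I_n -> T -> T') (law : set T' -> \bar R) : Prop :=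
  mutual_indep Q (fun i => sigma_of (S i)) /\
  forall i A, measurable A -> Q (S i @^-1` A) = law A.

Definition cvg_in_probability d (T : measurableType d) (R : realType)
    (Q : probability T R) (V : normedModType R) (u : nat -> T -> V) (v : V) :
  Prop :=
  forall e : R, 0 < e -> (fun m => Q [set w | e <= `|u m w - v|]) @ \oo --> 0%E.

Section vectors.
Context (R : realType) (d : nat).

Definition vec (x : d.-tuple R) : 'cV[R]_d := \col_j tnth x j.

Definition slopes (gamma : 'cV[R]_d.+1) : 'cV[R]_d := row' ord0 gamma.

Definition dot (u v : 'cV[R]_d) : R := (u^T *m v) 0 0.

End vectors.

Section population.
Context dO (Omega : measurableType dO) (R : realType) (P : probability Omega R).
Context (d K : nat).

Definition linear_model (Y : {RV P >-> R}) (X : {RV P >-> d.-tuple R})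
    (G : Omega -> 'I_K) (eps : {RV P >-> R}) (beta : 'cV[R]_d.+1)
    (sigma2 : R) : Prop :=
  [/\ {ae P, forall w,
        Y w = beta ord0 0 + dot (slopes beta) (vec (X w)) + eps w},
      indep_systems P (sigma_of eps) (sigma_pair X G),
      ('E_P[eps] = 0)%E &
      ('V_P[eps] = sigma2%:E)%E].

Definition cond_mean_X (X : {RV P >-> d.-tuple R}) (G : Omega -> 'I_K) (k : 'I_K) :
    'cV[R]_d :=
  \col_j cond_expect P (G @^-1` [set k]) (fun w => tnth (X w) j).

(* The matrix whose k-th row is (1, E(X | G = k)^T). *)
Definition mu1X (X : {RV P >-> d.-tuple R}) (G : Omega -> 'I_K) :
    'M[R]_(K, 1 + d) :=
  row_mx (const_mx 1) (\matrix_(k, j) cond_mean_X X G k j 0).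

End population.

Section estimator.
Context (R : realType) (d K : nat).

Definition mean_Y n (y : 'I_n -> R) : R := n%:R^-1 * \sum_i y i.

Definition var_Y n (y : 'I_n -> R) : R :=
  n%:R^-1 * \sum_i y i ^+ 2 - mean_Y y ^+ 2.

Definition mean_X n (x : 'I_n -> d.-tuple R) : 'cV[R]_d :=
  n%:R^-1 *: \sum_i vec (x i).

Definition cov_X n (x : 'I_n -> d.-tuple R) : 'M[R]_d :=
  n%:R^-1 *: (\sum_i vec (x i) *m (vec (x i))^T) - mean_X x *m (mean_X x)^T.

Definition phi (pi_ : 'I_K -> R) (ny nx : 'I_K -> nat)
    (y : forall k, 'I_(ny k) -> R) (x : forall k, 'I_(nx k) -> d.-tuple R)
    (p : 'cV[R]_d.+1 * R) : R :=
  let g := slopes p.1 in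
  \sum_k pi_ k *
    ((mean_Y (y k) - p.1 ord0 0 - dot g (mean_X (x k))) ^+ 2 +
     (Num.sqrt (var_Y (y k)) - Num.sqrt (dot g (cov_X (x k) *m g) + p.2)) ^+ 2).

Definition minimizes_over (T : Type) (Theta : set T) (f : T -> R) (t : T) : Prop :=
  Theta t /\ forall p, Theta p -> f t <= f p.

(* The neutral element is the maximum of all the sizes, so that for K > 0 this
   is their minimum. *)
Definition n_min (ny nx : 'I_K -> nat) : nat :=
  (\big[minn/(\max_(k < K) maxn (ny k) (nx k))]_(k < K) minn (ny k) (nx k))%N.

End estimator.

Section data.
Context dO (Omega : measurableType dO) dO' (Omega' : measurableType dO').
Context (R : realType) (P : probability Omega R) (Q : probability Omega' R).
Context (d K : nat).

(* The 2K mutually independent i.i.d. samples from the conditional laws of Y and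
   of X given G = k. They live on their own probability space, so that nothing
   is assumed about their joint law with (X, Y, G). *)
Definition two_sample_data (Y : {RV P >-> R}) (X : {RV P >-> d.-tuple R})
    (G : Omega -> 'I_K) (ny nx : 'I_K -> nat)
    (Ys : forall k, 'I_(ny k) -> {RV Q >-> R})
    (Xs : forall k, 'I_(nx k) -> {RV Q >-> d.-tuple R}) : Prop :=
  [/\ forall k, iid_sample Q (fun i => Ys k i)
        (fun A => cond_prob P (G @^-1` [set k]) (Y @^-1` A)),
      forall k, iid_sample Q (fun i => Xs k i)
        (fun A => cond_prob P (G @^-1` [set k]) (X @^-1` A)) &
      mutual_indep Q (fun s : 'I_K + 'I_K =>
        match s with
        | inl k => g_sigma_preimage (fun i => Ys k i)
        | inr k => g_sigma_preimage (fun i => Xs k i)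
        end)].

End data.

(* Main.v *)
Require Import Defs.
From HB Require Import structures.
From mathcomp Require Import all_boot all_order all_algebra.
From mathcomp Require Import all_classical all_reals all_analysis measurable_realfun.
From mathcomp Require Import ring lra.

Set Implicit Arguments.
Unset Strict Implicit.
Unset Printing Implicit Defensive.

Import Order.TTheory GRing.Theory Num.Theory.
Import numFieldNormedType.Exports.

Local Open Scope classical_set_scope.
Local Open Scope ring_scope.

(* Conditionally on G = k, the noise keeps its law and is independent of X, so
   the moments satisfy E(Y|k) = beta_0 + beta_{-0}^T mu_X^k and
   Var(Y|k) = beta_{-0}^T Gamma_X^k beta_{-0} + sigma2: the population loss
   vanishes at the true parameter.  Conversely, if it vanishes at (gamma, s) the
   first family of identities and the rank condition give gamma = beta, and then
   the second one gives s = sigma2.  By the weak law of large numbers (only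
   first moments of Y^2 and X_i X_j are available, hence an L^1 version) the
   sample moments converge in probability, so phi_n converges to the population
   loss jointly in the parameter and the sample; over the compact Theta, a
   minimizer of phi_n is eventually close to the unique minimizer of the
   limit. *)

(** * Expectation of a product when the joint law factorizes *)

Section product_rule.
Context d d1 d2 (T : measurableType d) (T1 : measurableType d1)
  (T2 : measurableType d2) (R : realType).
Context (mu : probability T R) (m1 : probability T1 R) (m2 : probability T2 R).
Context (S1 : T -> T1) (S2 : T -> T2) (h1 : T1 -> R) (h2 : T2 -> R).
Hypothesis mS1 : measurable_fun setT S1.
Hypothesis mS2 : measurable_fun setT S2.
Hypothesis muE : forall A B, measurable A -> measurable B ->
  (mu (S1 @^-1` A `&` S2 @^-1` B) = m1 A * m2 B)%E.
Hypothesis ih1 : m1.-integrable setT (EFin \o h1).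
Hypothesis ih2 : m2.-integrable setT (EFin \o h2).

Let S (x : T) : T1 * T2 := (S1 x, S2 x).
Let h (z : T1 * T2) : \bar R := (h1 z.1 * h2 z.2)%:E.

Let mS : measurable_fun setT S.
Proof. exact: measurable_fun_pair. Qed.

Let mh1 : measurable_fun setT h1.
Proof. exact/measurable_EFinP/(measurable_int m1). Qed.

Let mh2 : measurable_fun setT h2.
Proof. exact/measurable_EFinP/(measurable_int m2). Qed.

Let mh : measurable_fun setT h.
Proof.
apply/measurable_EFinP/measurable_funM.
- exact: (measurableT_comp mh1 measurable_fst).
- exact: (measurableT_comp mh2 measurable_snd).
Qed.

(** Rectangles determine the product measure, so [muE] makes it the law of the pair [S]. *)
Let joint_law A : measurable A -> (m1 \x m2)%E A = pushforward mu S A.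
Proof.
move=> mA.
pose SM := MeasurableFun.Pack
  (MeasurableFun.Class (isMeasurableFun.Build _ _ _ _ _ mS)).
rewrite -[RHS]/(distribution mu SM A).
exact: product_measure_unique.
Qed.

Let int_norm d' (T' : measurableType d') (m : probability T' R) (g : T' -> R) :
  m.-integrable setT (EFin \o g) ->
  exists2 r, 0 <= r & (\int[m]_y `|(g y)%:E| = r%:E)%E.
Proof.
move=> /integrableP[mg goo].
have g0 : (0 <= \int[m]_y `|(g y)%:E|)%E by exact: integral_ge0.
exists (fine (\int[m]_y `|(g y)%:E|)%E); first exact: fine_ge0.
by rewrite fineK// ge0_fin_numE.
Qed.

Let ih : (m1 \x m2)%E.-integrable setT h.
Proof.
apply/integrable12ltyP => //.
(* Tonelli: the absolute moments are named as real numbers, so that the iterated integral of the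
   absolute value is visibly a finite product. *)
have [r2 r20 E2] := int_norm ih2.
have [r1 r10 E1] := int_norm ih1.
under eq_integral => x _.
  under eq_integral => y _ do rewrite /h/= normrM EFinM.
  rewrite ge0_integralZl//; last first.
    by apply/measurable_EFinP/measurableT_comp.
  rewrite E2; over.
rewrite ge0_integralZr//; last by apply/measurable_EFinP/measurableT_comp.
by rewrite E1 -EFinM ltry.
Qed.

Lemma integrable_indepM :
  mu.-integrable setT (EFin \o (fun x => h1 (S1 x) * h2 (S2 x))).
Proof.
apply/integrableP; split; first exact: (measurableT_comp mh mS).
have /integrableP[_] := ih; apply: le_lt_trans.
rewrite (eq_measure_integral (pushforward mu S)); last first.
  by move=> A mA _; exact: joint_law.
rewrite ge0_integral_pushforward//.
exact: measurableT_comp.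
Qed.

(** A change of variables moves the integral to the product measure, where Fubini separates the two
    factors. *)
Lemma Rintegral_indepM :
  \int[mu]_x (h1 (S1 x) * h2 (S2 x)) =
  (\int[m1]_x h1 x) * (\int[m2]_y h2 y).
Proof.
have f1 : (\int[m1]_x (h1 x)%:E)%E \is a fin_num by exact: integrable_fin_num.
have f2 : (\int[m2]_x (h2 x)%:E)%E \is a fin_num by exact: integrable_fin_num.
rewrite /Rintegral -fineM//; congr fine.
have -> : (\int[mu]_x (h1 (S1 x) * h2 (S2 x))%:E =
    \int[(m1 \x m2)%E]_z h z)%E.
  rewrite (eq_measure_integral (pushforward mu S)); last first.
    by move=> A mA _; exact: joint_law.
  by rewrite integral_pushforward//; exact: integrable_indepM.
rewrite -integral12_prod_meas1//.
transitivity (\int[m1]_x ((h1 x)%:E * \int[m2]_y (h2 y)%:E))%E; last first.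
  by rewrite -(fineK f2) integralZr// fineK.
apply: eq_integral => x _; rewrite /fubini_F /h/=.
under eq_integral => y _ do rewrite EFinM.
by rewrite integralZl.
Qed.

End product_rule.

(** * Conditioning on an event of positive probability *)

Section conditional_probability.
Context d (T : measurableType d) (R : realType) (P : probability T R).
Context (B : set T) (mB : measurable B).

(* The second argument of mnormalize is a default for P B = 0. *)
Definition conditional : set T -> \bar R := mnormalize (mrestr P mB) P.

HB.instance Definition _ := Probability.on conditional.

Hypothesis PB : (0 < P B)%E.

Let PBfin : P B \is a fin_num.
Proof. exact: fin_num_measure. Qed.

Lemma fine_prob_gt0 : 0 < fine (P B).
Proof. by rewrite fine_gt0// PB /= -ge0_fin_numE. Qed.

Let invPB : {nonneg R} := NngNum (ltW (etrans (invr_gt0 _) fine_prob_gt0)).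

Lemma conditionalE A : conditional A = cond_prob P B A.
Proof.
have E : mrestr P mB setT = P B by rewrite /mrestr setTI.
rewrite /conditional /mnormalize/=. rewrite E ifF; last first.
  apply/negbTE; rewrite negb_or; apply/andP; split.
    by rewrite gt_eqF.
  by move: PBfin; rewrite fin_numE => /andP[].
rewrite /cond_prob -{2}(fineK PBfin) inver ifF// gt_eqF//.
exact: fine_prob_gt0.
Qed.

(** As a scaled restriction of [P], the conditional probability has computable integrals. *)
Let conditional_mscale A : conditional A = mscale invPB (mrestr P mB) A.
Proof.
rewrite conditionalE /cond_prob /mscale/= /mrestr muleC -{1}(fineK PBfin) inver.
by rewrite ifF// gt_eqF// fine_prob_gt0.
Qed.

Lemma ge0_integral_conditional (f : T -> \bar R) :
  measurable_fun setT f -> (forall x, 0 <= f x)%E ->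
  (\int[conditional]_x f x = (fine (P B))^-1%:E * \int[P]_(x in B) f x)%E.
Proof.
move=> mf f0.
rewrite (eq_measure_integral (mscale invPB (mrestr P mB))); last first.
  by move=> A _ _; exact: conditional_mscale.
rewrite ge0_integral_mscale//=; congr (_ * _)%E.
(* Split the space at [B]: the restricted measure agrees with [P] on subsets of [B] and vanishes on
   subsets of the complement. *)
rewrite -(setUv B) ge0_integral_setU//=; last 3 first.
- exact: measurableC.
- by rewrite setUv.
- by apply/disj_setPS => x [] /=.
rewrite [X in (_ + X)%E](_ : _ = 0%E) ?adde0.
  by apply: eq_measure_integral => A mA AB; rewrite /= /mrestr setIidl.
apply/eqP; rewrite eq_le integral_ge0// andbT.
rewrite (eq_measure_integral mzero) ?integral_measure_zero//.
move=> A mA AB; rewrite /mzero /= /mrestr.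
by rewrite (_ : A `&` B = set0) ?measure0//; apply/seteqP; split=> x // [/AB].
Qed.

Lemma integrable_conditional (f : T -> R) :
  P.-integrable setT (EFin \o f) -> conditional.-integrable setT (EFin \o f).
Proof.
move=> /integrableP[mf foo]; apply/integrableP; split => //.
rewrite ge0_integral_conditional//; last exact: measurableT_comp.
rewrite lte_mul_pinfty ?lee_fin ?invr_ge0 ?fine_ge0//.
apply: le_lt_trans foo; apply: ge0_subset_integral => //.
exact: measurableT_comp.
Qed.

Lemma Rintegral_conditional (f : T -> R) :
  P.-integrable setT (EFin \o f) ->
  \int[conditional]_x f x = cond_expect P B f.
Proof.
move=> fi.
have fiB : P.-integrable B (EFin \o f) by exact: integrableS fi.
have mf : measurable_fun setT (EFin \o f) by exact: measurable_int fi.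
rewrite /cond_expect /Rintegral mulrC -[X in X * _]/(fine (_%:E)) -fineM//; last first.
  exact: integrable_fin_num.
congr fine.
rewrite [LHS]integralE [in RHS]integralE.
rewrite !ge0_integral_conditional//; last 2 first.
- exact: measurable_funeneg.
- exact: measurable_funepos.
rewrite -muleBr//.
(* Finiteness of the negative part excludes an undefined difference of infinities when the scalar is
   factored out. *)
have ?: (\int[P]_(x in B) (EFin \o f)^\- x)%E \is a fin_num.
  by apply: integrable_fin_num => //; exact: integrable_funeneg.
by rewrite fin_num_adde_defl// fin_numN.
Qed.

Lemma ae_conditional (p : T -> Prop) :
  {ae P, forall x, p x} -> {ae conditional, forall x, p x}.
Proof.
move=> [N [mN PN pN]]; exists N; split => //.
rewrite /= conditionalE /cond_prob (_ : P (N `&` B) = 0%E) ?mul0e//.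
apply/eqP; rewrite eq_le measure_ge0 andbT -PN.
by apply: le_measure; rewrite ?inE//; exact: measurableI.
Qed.

End conditional_probability.

(** * Convergence in probability as convergence along a filter *)

Section in_probability.
Context d (T : measurableType d) (R : realType) (Q : probability T R).

(* Convergence in probability of m |-> u m is convergence of the uncurried
   u along this filter, so that continuous mapping arguments become ordinary
   limits. *)
Definition in_probability : set_system (nat * T) :=
  [set A | exists B : nat -> set T,
    [/\ forall m, measurable (B m), forall m w, ~ A (m, w) -> B m w &
        Q (B m) @[m --> \oo] --> 0%E]].

Global Instance in_probability_filter : Filter in_probability.
Proof.
split.
- exists (fun=> set0); split => [m|m w /(_ I)|]//.
  rewrite [X in X @ _](_ : _ = cst 0%E); first exact: cvg_cst.
  by apply/funext => m /=; rewrite measure0.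
- move=> A1 A2 [B1 [mB1 AB1 B10]] [B2 [mB2 AB2 B20]].
  exists (fun m => B1 m `|` B2 m); split.
  + by move=> m; exact: measurableU.
  + by move=> m w /not_andP[/AB1|/AB2]; [left|right].
  + apply: (@squeeze_cvge _ _ _ _ (cst 0%E) _
      (fun m => Q (B1 m) + Q (B2 m))%E).
    * by apply: nearW => m; rewrite measure_ge0/= measureU2.
    * exact: cvg_cst.
    * by rewrite -[X in _ --> X](adde0 0%E); apply: cvgeD.
- move=> A1 A2 A12 [B [mB AB B0]]; exists B; split => // m w A2mw.
  by apply: AB => /A12.
Qed.

Lemma in_probabilityP (u : nat -> T -> R) (l : R) :
  (forall m, measurable_fun setT (u m)) ->
  (forall e, 0 < e -> Q [set w | e <= `|u m w - l|] @[m --> \oo] --> 0%E) ->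
  u p.1 p.2 @[p --> in_probability] --> l.
Proof.
move=> mu u0; apply/cvgrPdist_lt => e e0.
exists (fun m => [set w | e <= `|u m w - l|]); split.
- move=> m; rewrite -[X in measurable X]setTI.
  apply: measurable_fun_le => //.
  by apply: measurableT_comp => //; exact: measurable_funB.
- by move=> m w /= /negP; rewrite -leNgt distrC.
- exact: u0.
Qed.

End in_probability.

(** * Integrals of finite sums and multiples *)

Section finite_sums.
Context d (T : measurableType d) (R : realType).
Context (mu : {measure set T -> \bar R}).

Lemma integrable_sumR (I : finType) (f : I -> T -> R) :
  (forall i, mu.-integrable setT (EFin \o f i)) ->
  mu.-integrable setT (EFin \o (fun x => \sum_i f i x)).
Proof.
move=> fi.
have : mu.-integrable setT (fun x => \sum_i (f i x)%:E)%E.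
  by apply: integrable_sum => // i _; exact: fi.
by apply: eq_integrable => // x _ /=; rewrite -sumEFin.
Qed.

Lemma Rintegral_sum (I : finType) (f : I -> T -> R) :
  (forall i, mu.-integrable setT (EFin \o f i)) ->
  \int[mu]_x (\sum_i f i x) = \sum_i \int[mu]_x f i x.
Proof.
move=> fi; rewrite /Rintegral sum_fine; last first.
  by move=> i _; apply: integrable_fin_num => //; exact: fi.
rewrite -(integral_sum measurableT fi).
by congr fine; apply: eq_integral => x _; rewrite -sumEFin.
Qed.

Lemma integrableZR (c : R) (f : T -> R) :
  mu.-integrable setT (EFin \o f) ->
  mu.-integrable setT (EFin \o (fun x => c * f x)).
Proof. exact: integrableZl. Qed.

Lemma integrableDR (f g : T -> R) :
  mu.-integrable setT (EFin \o f) -> mu.-integrable setT (EFin \o g) ->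
  mu.-integrable setT (EFin \o (fun x => f x + g x)).
Proof. exact: integrableD. Qed.

End finite_sums.

Lemma Rintegral_probability_cst d (T : measurableType d) (R : realType)
  (mu : probability T R) (r : R) : \int[mu]_x r = r.
Proof.
rewrite Rintegral_cst//; have := probability_setT mu => /= ->.
by rewrite mulr1.
Qed.

(** * First and second moments of i.i.d. samples *)

Section weak_law.
Context d d' (T : measurableType d) (T' : measurableType d') (R : realType).
Context (Q : probability T R) (mu : probability T' R).

(** The second moment of a mean involves two observations at a time, so mutual independence enters
    only through the subfamily of the indices [i] and [j]. *)
Lemma iid_sample_pair n (S : 'I_n -> T -> T') : iid_sample Q S mu ->
  forall i j, i != j -> forall A B, measurable A -> measurable B ->
  (Q (S i @^-1` A `&` S j @^-1` B) = mu A * mu B)%E.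
Proof.
move=> [ind law] i j ij A B mA mB.
rewrite -(law i A mA) -(law j B mB).
pose E k := if k == i then S i @^-1` A else S j @^-1` B.
have := ind [set i; j]%SET E.
rewrite big_setU1 ?inE//= big_set1.
rewrite /E eqxx eq_sym (negbTE ij) => <-.
  congr (Q _); apply/seteqP; split=> [w [wA wB] k /=|w].
    by rewrite !inE => /orP[]/eqP ->; rewrite ?eqxx// eq_sym (negbTE ij).
  move=> h; split.
    by have := h i; rewrite /= !inE !eqxx; exact.
  by have := h j; rewrite /= !inE eqxx orbT eq_sym (negbTE ij); exact.
move=> k; rewrite !inE => /orP[]/eqP ->.
  by rewrite eqxx; exists A => //; rewrite setTI.
by rewrite eq_sym (negbTE ij); exists B => //; rewrite setTI.
Qed.

Section fixed_size.
Context n (S : 'I_n -> T -> T').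
Hypothesis mS : forall i, measurable_fun setT (S i).
Hypothesis iidS : iid_sample Q S mu.

Let law_pushforward i A : measurable A -> pushforward Q (S i) A = mu A.
Proof. by move=> mA; have [_ law] := iidS; exact: law. Qed.

Lemma integrable_sample (h : T' -> R) i : mu.-integrable setT (EFin \o h) ->
  Q.-integrable setT (EFin \o (h \o S i)).
Proof.
move=> /integrableP[mh hoo]; apply/integrableP; split.
  by apply: (measurableT_comp mh).
apply: le_lt_trans hoo.
rewrite (eq_measure_integral (pushforward Q (S i))); last first.
  by move=> A mA _; exact/esym/law_pushforward.
by rewrite ge0_integral_pushforward//; exact: measurableT_comp.
Qed.

Lemma Rintegral_sample (h : T' -> R) i : mu.-integrable setT (EFin \o h) ->
  \int[Q]_w h (S i w) = \int[mu]_x h x.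
Proof.
move=> ih; rewrite /Rintegral; congr fine.
rewrite [RHS](eq_measure_integral (pushforward Q (S i))); last first.
  by move=> A mA _; exact/esym/law_pushforward.
rewrite integral_pushforward//; last exact: integrable_sample.
exact: measurable_int ih.
Qed.

(** The diagonal uses the second moment of [h]; off the diagonal, independence and the first moment
    suffice. *)
Let integrable_sampleM (h : T' -> R) i j : mu.-integrable setT (EFin \o h) ->
  mu.-integrable setT (EFin \o (fun x => h x ^+ 2)) ->
  Q.-integrable setT (EFin \o (fun w => h (S i w) * h (S j w))).
Proof.
move=> ih ih2; have [->|ij] := eqVneq i j.
  exact: (integrable_sample j ih2).
exact: (integrable_indepM _ _ (iid_sample_pair iidS ij)).
Qed.

(** The square of the sum is a double sum: independence and centering kill the off-diagonal terms,
    and the [n] equal diagonal terms turn the factor [n^-2] into [n^-1]. *)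
Lemma Rintegral_sqr_mean (h : T' -> R) : (0 < n)%N ->
  mu.-integrable setT (EFin \o h) ->
  mu.-integrable setT (EFin \o (fun x => h x ^+ 2)) ->
  \int[mu]_x h x = 0 ->
  Q.-integrable setT (EFin \o (fun w => (n%:R^-1 * \sum_i h (S i w)) ^+ 2)) /\
  \int[Q]_w ((n%:R^-1 * \sum_i h (S i w)) ^+ 2) =
    n%:R^-1 * \int[mu]_x (h x ^+ 2).
Proof.
move=> n0 ih ih2 h0.
have E w : (n%:R^-1 * \sum_i h (S i w)) ^+ 2 =
    n%:R^-2 * \sum_i \sum_j (h (S i w) * h (S j w)).
  rewrite exprMn exprVn; congr (_ * _).
  by rewrite expr2 mulr_suml; apply: eq_bigr => i _; rewrite mulr_sumr.
under [in X in X /\ _]eq_fun do rewrite E.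
have ij i j := @integrable_sampleM h i j ih ih2.
have iS : Q.-integrable setT
    (EFin \o (fun w => \sum_i \sum_j (h (S i w) * h (S j w)))).
  by apply: integrable_sumR => i; exact: integrable_sumR.
split; first exact: integrableZR.
under eq_Rintegral do rewrite E.
rewrite RintegralZl// Rintegral_sum; last by move=> i; exact: integrable_sumR.
rewrite (eq_bigr (fun=> \int[mu]_x (h x ^+ 2))) => [|i _]; last first.
  rewrite Rintegral_sum// (bigD1 i)//= big1 ?addr0 => [|j ji].
    exact: (Rintegral_sample i ih2).
  rewrite eq_sym in ji.
  by rewrite (Rintegral_indepM _ _ (iid_sample_pair iidS ji) ih ih)// h0 mul0r.
rewrite sumr_const card_ord -[X in _ * X]mulr_natl mulrA; congr (_ * _).
by rewrite expr2 invfM mulrAC mulVf ?mul1r// pnatr_eq0 -lt0n.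
Qed.

End fixed_size.
End weak_law.

(** * The weak law of large numbers under a first moment *)

Section weak_law_large_numbers.
Context d d' (T : measurableType d) (T' : measurableType d') (R : realType).
Context (Q : probability T R) (mu : probability T' R).

Import HBSimple.

(** Simple functions are dense in L^1 and, being bounded, are square integrable for a
    probability. *)
Lemma L1_approx_L2 (f : T' -> R) (e : R) : 0 < e ->
  mu.-integrable setT (EFin \o f) ->
  exists g : T' -> R,
    [/\ mu.-integrable setT (EFin \o g),
        mu.-integrable setT (EFin \o (fun x => g x ^+ 2)) &
        \int[mu]_x `|f x - g x| <= e].
Proof.
move=> e0 fi.
have [g [gi _ g0]] := approximation_sfun_integrable measurableT fi.
have /fine_cvgP[_ /cvgrPdist_lt/(_ e e0)[N _ /(_ N (leqnn N))/=]] := g0.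
rewrite sub0r normrN => gN.
exists (g N); split; first exact: gi.
- apply: (@measurable_bounded_integrable _ _ _ mu) => //.
  + by rewrite (le_lt_trans (probability_le1 _ _))// ltry.
  + by apply/measurable_funX.
  + have [M [Mr M1]] : bounded_fun (g N) by exact: simple_bounded.
    (* Boundedness provides a bound only for reals strictly above [M]; [|M| + 1] is one, and it is
       nonnegative, so squaring keeps the order. *)
    exists ((`|M| + 1) ^+ 2); split; first exact: num_real.
    move=> r /ltW rM x _; rewrite /= (le_trans _ rM)// normrX.
    by rewrite lerXn2r ?nnegrE ?addr_ge0// M1// ltr_pwDr// ler_norm.
- exact: (le_trans (ler_norm _) (ltW gN)).
Qed.

Lemma markov_L1 (Z : T -> R) (e : R) : 0 < e ->
  Q.-integrable setT (EFin \o Z) ->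
  fine (Q [set w | e <= `|Z w|]) <= e^-1 * \int[Q]_w `|Z w|.
Proof.
move=> e0 Zi.
have mZ : measurable_fun setT Z by exact/measurable_EFinP/(measurable_int Q).
pose ZM := MeasurableFun.Pack
  (MeasurableFun.Class (isMeasurableFun.Build _ _ _ _ _ mZ)).
have mA : measurable [set w | e <= `|Z w|].
  rewrite -[X in measurable X]setTI.
  by apply: measurable_fun_le => //; exact: measurableT_comp.
have := @markov _ _ _ Q ZM idfun e e0 (@measurable_id _ _ setT) (fun _ => id)
  (fun x y _ _ => id).
rewrite expectation.unlock/= => M.
rewrite ler_pdivlMl// -lee_fin EFinM !fineK//.
- by apply: integrable_fin_num => //; exact: integrable_norm.
- exact: fin_num_measure.
Qed.

(** Truncation argument: [f] has only a first moment, so the [1/n] decay comes from a square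
    integrable [g], at the price of twice the L^1 distance from [f] to [g]. The free parameter [eta]
    converts the second moment of the mean of [g] into a bound on its first absolute moment. *)
Lemma L1_deviation n (S : 'I_n -> T -> T') (f g : T' -> R) (eta : R) :
  (0 < n)%N -> 0 < eta ->
  (forall i, measurable_fun setT (S i)) -> iid_sample Q S mu ->
  mu.-integrable setT (EFin \o f) -> mu.-integrable setT (EFin \o g) ->
  mu.-integrable setT (EFin \o (fun x => g x ^+ 2)) ->
  let Z w := n%:R^-1 * \sum_i f (S i w) - \int[mu]_x f x in
  let C := \int[mu]_x ((g x - \int[mu]_x g x) ^+ 2) in
  Q.-integrable setT (EFin \o Z) /\
  \int[Q]_w `|Z w| <=
    eta^-1 * (n%:R^-1 * C) + eta + 2 * \int[mu]_x `|f x - g x|.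
Proof.
move=> n0 eta0 mS iidS fi gi g2i Z C.
pose cg := \int[mu]_x g x; pose h x := g x - cg.
have csti r : mu.-integrable setT (EFin \o cst r).
  exact: finite_measure_integrable_cst.
have cstiQ r : Q.-integrable setT (EFin \o cst r).
  exact: finite_measure_integrable_cst.
have hi : mu.-integrable setT (EFin \o h) by exact: (integrableDR gi (csti (- cg))).
have h2i : mu.-integrable setT (EFin \o (fun x => h x ^+ 2)).
  have -> : (fun x => h x ^+ 2) =
      (fun x => g x ^+ 2 + (- (2 * cg) * g x + cg ^+ 2)).
    by apply/funext => x; rewrite /h; ring.
  exact: (integrableDR g2i
    (integrableDR (integrableZR (- (2 * cg)) gi) (csti (cg ^+ 2)))).
have h0 : \int[mu]_x h x = 0.
  rewrite /h RintegralB//; last exact: csti.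
  by rewrite Rintegral_probability_cst subrr.
have [V_int VE] := Rintegral_sqr_mean mS iidS n0 hi h2i h0.
have rn0 : n%:R != 0 :> R by rewrite pnatr_eq0 -lt0n.
have fgi : mu.-integrable setT (EFin \o (fun x => f x - g x)).
  exact: (integrableB measurableT fi gi).
have nfgi : mu.-integrable setT (EFin \o (fun x => `|f x - g x|)).
  exact: integrable_norm fgi.
have Zi : Q.-integrable setT (EFin \o Z).
  apply: (integrableDR _ (cstiQ (- \int[mu]_x f x))).
  apply: integrableZR; apply: integrable_sumR => i.
  exact: (integrable_sample mS iidS i fi).
split => //.
set I := \int[mu]_x `|f x - g x|.
have I0 : `|\int[mu]_x f x - cg| <= I.
  by rewrite -RintegralB// le_normr_Rintegral.
pose W w := n%:R^-1 * \sum_i h (S i w).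
pose A w := n%:R^-1 * \sum_i `|f (S i w) - g (S i w)|.
have Ai : Q.-integrable setT (EFin \o A).
  apply: integrableZR; apply: integrable_sumR => i.
  exact: (integrable_sample mS iidS i nfgi).
have AE : \int[Q]_w A w = I.
  rewrite RintegralZl//; last first.
    apply: integrable_sumR => i.
    exact: (integrable_sample mS iidS i nfgi).
  rewrite Rintegral_sum; last first.
    by move=> i; exact: (integrable_sample mS iidS i nfgi).
  rewrite (eq_bigr (fun=> I)) => [|i _]; last first.
    exact: (Rintegral_sample mS iidS i nfgi).
  by rewrite sumr_const card_ord -[X in _ * X]mulr_natl mulKf.
have ZW w : `|Z w| <= eta^-1 * W w ^+ 2 + (eta + I) + A w.
  (* Three parts: the centred mean of [g], the empirical mean of [f - g], and the difference of the
     two expectations. *)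
  have -> : Z w = W w + n%:R^-1 * (\sum_i (f (S i w) - g (S i w)))
      - (\int[mu]_x f x - cg).
    rewrite /Z /W -mulrDr -big_split/=.
    rewrite [X in _ = _ * X - _](eq_bigr (fun i => f (S i w) - cg)) => [|i _]; last first.
      by rewrite /h addrC addrA subrK.
    rewrite big_split/= sumr_const card_ord -[X in _ = _ * (_ + X) - _]mulr_natl mulrDr mulKf//.
    ring.
  apply: le_trans (ler_normB _ _) _.
  have aA : `|n%:R^-1 * (\sum_i (f (S i w) - g (S i w)))| <= A w.
    rewrite normrM ger0_norm ?invr_ge0// ler_wpM2l ?invr_ge0//.
    exact: ler_norm_sum.
  have aW : `|W w| <= eta^-1 * W w ^+ 2 + eta.
    (* AM-GM *)
    rewrite -(ler_pM2l eta0) mulrDr mulVKf ?gt_eqF//.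
    rewrite -(real_normK (num_real (W w))).
    have := normr_ge0 (W w); nra.
  have := ler_normD (W w) (n%:R^-1 * (\sum_i (f (S i w) - g (S i w)))).
  lra.
pose B w := eta^-1 * W w ^+ 2 + (eta + I) + A w.
have B1i : Q.-integrable setT (EFin \o (fun w => eta^-1 * W w ^+ 2 + (eta + I))).
  exact: (integrableDR (integrableZR eta^-1 V_int) (cstiQ (eta + I))).
have Bi : Q.-integrable setT (EFin \o B) by exact: (integrableDR B1i Ai).
apply: (@le_trans _ _ (\int[Q]_w B w)).
  by apply: le_Rintegral => //; exact: integrable_norm.
rewrite RintegralD// RintegralD//; [|exact: integrableZR|exact: cstiQ].
rewrite RintegralZl// VE AE Rintegral_probability_cst.
rewrite -[C]/(\int[mu]_x (h x ^+ 2)); lra.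
Qed.

(** Markov's inequality applied to the L^1 deviation, with [f] approximated closely enough before
    [n] grows. *)
Lemma weak_law (n : nat -> nat) (S : forall m, 'I_(n m) -> T -> T') (f : T' -> R) :
  (forall m i, measurable_fun setT (@S m i)) ->
  (forall m, iid_sample Q (@S m) mu) ->
  n @ \oo --> \oo ->
  mu.-integrable setT (EFin \o f) ->
  (n p.1)%:R^-1 * \sum_i f (S p.1 i p.2) @[p --> in_probability Q]
    --> \int[mu]_x f x.
Proof.
move=> mS iidS noo fi.
have mf : measurable_fun setT f by exact/measurable_EFinP/(measurable_int mu).
apply: (@in_probabilityP _ _ _ Q
    (fun m w => (n m)%:R^-1 * \sum_i f (S m i w))) => [m|e e0].
  apply: measurable_funM => //; apply: measurable_sum => i.
  exact: measurableT_comp.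
apply/fine_cvgP; split.
  apply: nearW => m; apply: fin_num_measure.
  rewrite -[X in measurable X]setTI; apply: measurable_fun_le => //.
  apply: measurableT_comp => //; apply: measurable_funB => //.
  apply: measurable_funM => //; apply: measurable_sum => i.
  exact: measurableT_comp.
apply/cvgrPdist_le => de de0.
(* The deviation bound will be at most [eta + eta + 2 * eta = e * de], and Markov's inequality
   divides it by [e]. *)
pose eta := e * de / 4.
have eta0 : 0 < eta by rewrite divr_gt0// mulr_gt0.
have [g [gi g2i fg]] := L1_approx_L2 eta0 fi.
pose C := \int[mu]_x ((g x - \int[mu]_x g x) ^+ 2).
have C0 : 0 <= C by apply: Rintegral_ge0 => x _; exact: sqr_ge0.
near=> m.
have n0 : (0 < n m)%N by near: m; exact: (noo _ (nbhs_infty_gt 0)).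
have [Zi Zle] := L1_deviation n0 eta0 (mS m) (iidS m) fi gi g2i.
rewrite sub0r normrN ger0_norm ?fine_ge0//.
apply: (le_trans (markov_L1 e0 Zi)).
rewrite ler_pdivrMl//; apply: (le_trans Zle); rewrite -/C.
(* This holds as soon as [n m] is at least [C / (eta * eta)]. *)
have Cn : eta^-1 * ((n m)%:R^-1 * C) <= eta.
  rewrite ler_pdivrMl// mulrC ler_pdivrMr ?ltr0n//.
  rewrite mulrC -ler_pdivrMr ?mulr_gt0//.
  near: m; exact: (noo _ (nbhs_infty_ger _)).
have : 4 * eta = e * de by rewrite /eta; field.
lra.
Unshelve. all: by end_near. Qed.

End weak_law_large_numbers.

(** * Convergence of minimizers over a compact set *)

Section argmin.
Context (R : realType) (V : topologicalType) (T : Type).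
Context (F : set_system T) {FF : Filter F}.

(** Joint convergence near each point of [Theta] stands in for uniform convergence. With compactness
    it keeps [L t] above its value at [x0] on all of [Theta] outside [U], whereas a minimizer has a
    value at most that at [x0]; hence it lies in [U]. *)
Lemma argmin_cvg (Theta : set V) (L : T -> V -> R) (L0 : V -> R) (x0 : V)
    (est : T -> V) :
  compact Theta -> Theta x0 ->
  (forall x, Theta x -> L p.2 p.1 @[p --> (nbhs x, F)] --> L0 x) ->
  (forall x, Theta x -> x <> x0 -> L0 x0 < L0 x) ->
  (forall t, minimizes_over Theta (L t) (est t)) ->
  est t @[t --> F] --> x0.
Proof.
move=> cTheta Tx0 Lcvg Lmin estP U Ux0.
have Lx0 : L t x0 @[t --> F] --> L0 x0.
  apply: (cvg_comp (fun t => (x0, t)) (fun p => L p.2 p.1) _ (Lcvg _ Tx0)).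
  by apply: cvg_pair => //; exact: cvg_cst.
(* Near-covering form of compactness: what holds near each [x] and eventually along [F] holds
   eventually for all points of [Theta] at once. *)
have /compact_near_coveringP cover := cTheta.
have := cover _ F (fun t x => U x \/ L t x0 < L t x) FF.
have cov x : Theta x ->
    \forall x' \near x & t \near F, U x' \/ L t x0 < L t x'.
  move=> Tx; have [->|xx0] := pselect (x = x0).
    by exists (U, setT); [split => //; exact: filterT|case=> y t [/= Uy _]; left].
  (* Away from [x0] the excess over the value at [x0] has a positive limit, jointly in the parameter
     and the index. *)
  have D : L p.2 p.1 - L p.2 x0 @[p --> (nbhs x, F)] --> L0 x - L0 x0.
    apply: cvgB; first exact: Lcvg.
    exact: (cvg_comp snd (fun t => L t x0) cvg_snd Lx0).
  have : \forall p \near (nbhs x, F), 0 < L p.2 p.1 - L p.2 x0.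
    by apply: (cvgr_gt _ D); rewrite subr_gt0; exact: Lmin.
  by apply: filterS => p; rewrite subr_gt0; right.
move=> /(_ cov); apply: filterS => t /= Ut.
have [Test /(_ _ Tx0)] := estP t.
by have [//|] := Ut _ Test; rewrite ltNge => /negP.
Qed.

End argmin.

(** * Continuity of the loss and identification of the parameter *)

Section loss.
Context (R : realType) (d K : nat).

Lemma dotE (u v : 'cV[R]_d) : dot u v = \sum_j u j 0 * v j 0.
Proof. by rewrite /dot mxE; apply: eq_bigr => j _; rewrite mxE. Qed.

Lemma dot_quadE (u : 'cV[R]_d) (A : 'M[R]_d) :
  dot u (A *m u) = \sum_i u i 0 * \sum_j A i j * u j 0.
Proof. by rewrite dotE; apply: eq_bigr => j _; rewrite mxE. Qed.

(* phi as a function of the sample moments. *)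
Definition loss (pi_ : 'I_K -> R) (mY vY : 'I_K -> R) (mX : 'I_K -> 'cV[R]_d)
    (CX : 'I_K -> 'M[R]_d) (p : 'cV[R]_d.+1 * R) : R :=
  let g := slopes p.1 in
  \sum_k pi_ k *
    ((mY k - p.1 ord0 0 - dot g (mX k)) ^+ 2 +
     (Num.sqrt (vY k) - Num.sqrt (dot g (CX k *m g) + p.2)) ^+ 2).

Lemma cvg_sumr (T : Type) (F : set_system T) {FF : Filter F} (I : finType)
    (f : I -> T -> R) (l : I -> R) :
  (forall i, f i t @[t --> F] --> l i) ->
  \sum_i f i t @[t --> F] --> \sum_i l i.
Proof. by move=> fl; apply: cvg_big => //; exact: add_continuous. Qed.

Lemma loss_cvg (T : Type) (F : set_system T) {FF : Filter F} pi_
    (mY vY : T -> 'I_K -> R) (mX : T -> 'I_K -> 'cV[R]_d)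
    (CX : T -> 'I_K -> 'M[R]_d) (q : T -> 'cV[R]_d.+1 * R)
    (mY0 vY0 : 'I_K -> R) (mX0 : 'I_K -> 'cV[R]_d)
    (CX0 : 'I_K -> 'M[R]_d) (q0 : 'cV[R]_d.+1 * R) :
  (forall k, mY t k @[t --> F] --> mY0 k) ->
  (forall k, vY t k @[t --> F] --> vY0 k) ->
  (forall k j, mX t k j 0 @[t --> F] --> mX0 k j 0) ->
  (forall k i j, CX t k i j @[t --> F] --> CX0 k i j) ->
  q t @[t --> F] --> q0 ->
  loss pi_ (mY t) (vY t) (mX t) (CX t) (q t) @[t --> F] -->
    loss pi_ mY0 vY0 mX0 CX0 q0.
Proof.
move=> mYc vYc mXc CXc qc.
have q1c : (q t).1 @[t --> F] --> q0.1 by apply: (cvg_comp q fst qc); exact: cvg_fst.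
have q2c : (q t).2 @[t --> F] --> q0.2 by apply: (cvg_comp q snd qc); exact: cvg_snd.
have bc j : (q t).1 j 0 @[t --> F] --> q0.1 j 0.
  apply: (cvg_comp _ (fun M : 'cV[R]_d.+1 => M j 0) q1c).
  exact: coord_continuous.
have gc j : slopes (q t).1 j 0 @[t --> F] --> slopes q0.1 j 0.
  by rewrite !mxE; under eq_fun do rewrite mxE; exact: bc.
have sqr (f : T -> R) (l : R) : f t @[t --> F] --> l -> f t ^+ 2 @[t --> F] --> l ^+ 2.
  by move=> fl; apply: cvgM.
apply: cvg_sumr => k; apply: cvgM; first exact: cvg_cst.
apply: cvgD; apply: sqr.
- apply: cvgB; first by apply: cvgB.
  rewrite dotE; under eq_fun do rewrite dotE.
  by apply: cvg_sumr => j; apply: cvgM.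
(* [Num.sqrt] is 0 on negative reals, hence continuous on the whole line; the radicand may be
   negative along [F], as [q] can approach [q0] through points with a negative variance
   coordinate. *)
- have sqrtc (f : T -> R) (l : R) : f t @[t --> F] --> l ->
      Num.sqrt (f t) @[t --> F] --> Num.sqrt l.
    by move=> fl; apply: (cvg_comp f _ fl); exact: sqrt_continuous.
  apply: cvgB; apply: sqrtc => //; apply: cvgD => //.
  rewrite dot_quadE; under eq_fun do rewrite dot_quadE.
  apply: cvg_sumr => i; apply: cvgM => //.
  by apply: cvg_sumr => j; apply: cvgM.
Qed.

(** This connects the affine predictor with the rows of the matrix in the rank condition. *)
Lemma dot_slopesE (b : 'cV[R]_d.+1) (v : 'cV[R]_d) :
  b ord0 0 + dot (slopes b) v = ((row_mx (const_mx 1) v^T : 'rV[R]_(1 + d)) *m b) 0 0.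
Proof.
rewrite dotE mxE big_split_ord/= big_ord1.
rewrite row_mxEl mxE mul1r; congr (b _ _ + _); first exact: val_inj.
apply: eq_bigr => j _; rewrite row_mxEr !mxE mulrC; congr (_ * b _ _).
exact: val_inj.
Qed.

Lemma loss_ge0 pi_ mY vY mX CX p : (forall k, 0 <= pi_ k) ->
  0 <= loss pi_ mY vY mX CX p.
Proof.
by move=> pi0; apply: sumr_ge0 => k _; rewrite mulr_ge0// addr_ge0// sqr_ge0.
Qed.

Lemma loss_eq0 pi_ mY vY mX CX p : (forall k, 0 < pi_ k) ->
  loss pi_ mY vY mX CX p = 0 -> forall k,
  mY k = p.1 ord0 0 + dot (slopes p.1) (mX k) /\
  Num.sqrt (vY k) = Num.sqrt (dot (slopes p.1) (CX k *m slopes p.1) + p.2).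
Proof.
move=> pi0 /eqP; rewrite psumr_eq0; last first.
  by move=> k _; rewrite mulr_ge0 ?(ltW (pi0 k))// addr_ge0// sqr_ge0.
move=> /allP L0 k; have := L0 k (mem_index_enum k).
rewrite mulf_eq0 gt_eqF//= paddr_eq0 ?sqr_ge0// !sqrf_eq0 => /andP[/eqP h1 /eqP h2].
by split; [lra|exact: subr0_eq].
Qed.

Lemma loss_identifies (pi_ mY vY : 'I_K -> R) (mX : 'I_K -> 'cV[R]_d)
    (CX : 'I_K -> 'M[R]_d) (q p : 'cV[R]_d.+1 * R) :
  (0 < K)%N -> (forall k, 0 < pi_ k) ->
  \rank (row_mx (const_mx 1) (\matrix_(k, j) mX k j 0) : 'M[R]_(K, 1 + d))
    = d.+1 ->
  (forall k, mY k = q.1 ord0 0 + dot (slopes q.1) (mX k)) ->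
  (forall k, vY k = dot (slopes q.1) (CX k *m slopes q.1) + q.2) ->
  (forall k, 0 <= dot (slopes q.1) (CX k *m slopes q.1)) ->
  0 <= q.2 -> 0 <= p.2 -> p <> q ->
  loss pi_ mY vY mX CX q < loss pi_ mY vY mX CX p.
Proof.
move=> K0 pi0 rk mYq vYq CX0 q20 p20 pq.
have -> : loss pi_ mY vY mX CX q = 0.
  by rewrite /loss big1// => k _; rewrite mYq vYq -addrA -opprD !subrr expr0n addr0 mulr0.
rewrite lt_neqAle loss_ge0 ?andbT => [|k]; last exact: ltW.
apply/eqP => /esym/(loss_eq0 pi0) p0; apply: pq.
set M := row_mx _ _ in rk.
have pq1 : p.1 = q.1.
  apply/eqP; rewrite -subr_eq0; apply/eqP.
  (* Both parameters reproduce the group means, so the difference of their coefficient vectors lies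
     in the kernel of [M]. *)
  have MD : (M : 'M[R]_(K, d.+1)) *m (p.1 - q.1) = 0.
    apply/matrixP => k i; rewrite ord1 mulmxBr !mxE.
    have [mYp _] := p0 k; move: (mYq k); rewrite mYp !dot_slopesE !mxE => e.
    apply/eqP; rewrite subr_eq0; apply/eqP; move: e.
    suff E (b : 'cV[R]_d.+1) : \sum_j (row_mx (const_mx 1) (mX k)^T : 'rV[R]_(1 + d)) 0 j * b j 0 =
        \sum_j M k j * b j 0 by rewrite !E.
    apply: eq_bigr => j _; congr (_ * _); rewrite /M.
    by case: (@split_ordP 1 d j) => i' ->; rewrite ?row_mxEl ?row_mxEr !mxE.
  (* Rank [d.+1] is full column rank, that is, free rows of the transpose; hence the kernel is
     trivial. *)
  have Mfree : row_free M^T by rewrite /row_free mxrank_tr rk.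
  apply: trmx_inj; rewrite trmx0; apply: (row_free_inj Mfree).
  by rewrite mul0mx -trmx_mul MD trmx0.
(* With equal coefficients a single group determines the noise variance: both radicands are
   nonnegative, so the square roots can be removed. *)
have [_] := p0 (Ordinal K0); rewrite vYq pq1 => /eqP.
rewrite eqr_sqrt ?addr_ge0// => /eqP/addrI pq2.
by case: p q pq1 pq2 {p0 mYq vYq CX0 q20 p20} => [? ?] [? ?] /= -> ->.
Qed.

End loss.

(** * Consequences of square integrability *)

Section square_integrable.
Context d (T : measurableType d) (R : realType) (mu : probability T R).

Lemma integrable_le (f g : T -> R) : measurable_fun setT f ->
  mu.-integrable setT (EFin \o g) -> (forall x, `|f x| <= g x) ->
  mu.-integrable setT (EFin \o f).
Proof.
move=> mf gi fg; apply: (le_integrable measurableT _ _ gi).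
  exact/measurable_EFinP.
by move=> x _ /=; rewrite lee_fin (le_trans (fg x))// ler_norm.
Qed.

Lemma integrableM_sqr (f g : T -> R) :
  measurable_fun setT f -> measurable_fun setT g ->
  mu.-integrable setT (EFin \o (fun x => f x ^+ 2)) ->
  mu.-integrable setT (EFin \o (fun x => g x ^+ 2)) ->
  mu.-integrable setT (EFin \o (fun x => f x * g x)).
Proof.
move=> mf mg f2 g2; apply: (integrable_le _ (integrableDR f2 g2)).
  exact: measurable_funM.
move=> x /=; rewrite normrM -(real_normK (num_real (f x))).
rewrite -(real_normK (num_real (g x))).
by have := normr_ge0 (f x); have := normr_ge0 (g x); nra.
Qed.

Lemma integrable_sqr (f : T -> R) : measurable_fun setT f ->
  mu.-integrable setT (EFin \o (fun x => f x ^+ 2)) ->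
  mu.-integrable setT (EFin \o f).
Proof.
move=> mf f2; have i1 : mu.-integrable setT (EFin \o (cst 1 : T -> R)).
  exact: finite_measure_integrable_cst.
apply: (integrable_le mf (integrableDR f2 i1)) => x /=.
rewrite -(real_normK (num_real (f x))); nra.
Qed.

Lemma integrable_sqr_lty (f : T -> R) : measurable_fun setT f ->
  ('E_mu[(fun x => f x ^+ 2)%R] < +oo)%E ->
  mu.-integrable setT (EFin \o (fun x => f x ^+ 2)).
Proof.
move=> mf; rewrite expectation.unlock => foo; apply/integrableP; split.
  by apply/measurable_EFinP; exact: measurable_funX.
apply: le_lt_trans foo; under eq_integral do rewrite /= ger0_norm ?sqr_ge0//.
exact: lexx.
Qed.

Lemma eq_ae_Rintegral (f g : T -> R) :
  measurable_fun setT f -> measurable_fun setT g ->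
  {ae mu, forall x, f x = g x} -> \int[mu]_x f x = \int[mu]_x g x.
Proof.
move=> mf mg fg; congr fine; apply: ae_eq_integral => //.
- exact/measurable_EFinP.
- exact/measurable_EFinP.
- by apply: filterS fg => x fgx _; rewrite fgx.
Qed.

(** The expression is the integral of the squared deviation from the mean, expanded. *)
Lemma variance_ge0_Rintegral (f : T -> R) : measurable_fun setT f ->
  mu.-integrable setT (EFin \o (fun x => f x ^+ 2)) ->
  0 <= \int[mu]_x (f x ^+ 2) - (\int[mu]_x f x) ^+ 2.
Proof.
move=> mf f2; set m := \int[mu]_x f x.
have fi := integrable_sqr mf f2.
have ci : mu.-integrable setT (EFin \o (cst (m ^+ 2) : T -> R)).
  exact: finite_measure_integrable_cst.
have fci := integrableDR (integrableZR (- (2 * m)) fi) ci.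
have : 0 <= \int[mu]_x ((f x - m) ^+ 2).
  by apply: Rintegral_ge0 => x _; exact: sqr_ge0.
rewrite (_ : \int[mu]_x _ =
    \int[mu]_x (f x ^+ 2 + (- (2 * m) * f x + m ^+ 2))); last first.
  by apply: eq_Rintegral => x _; ring.
rewrite RintegralD// RintegralD//; last exact: integrableZR.
rewrite RintegralZl// Rintegral_probability_cst -/m; lra.
Qed.

End square_integrable.

(** * Mean and variance of the response within one group, whose conditional probability is [mu] *)

Section linear_model_moments.
Context dO (Omega : measurableType dO) (R : realType) (d : nat).
Context (P mu : probability Omega R).
Context (Y eps : {mfun Omega >-> R}) (X : {mfun Omega >-> d.-tuple R}).
Context (b : 'cV[R]_d.+1) (sigma2 : R).
Hypothesis model : {ae mu, forall w,
  Y w = b ord0 0 + dot (slopes b) (vec (X w)) + eps w}.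
(** Two facts in one: under [mu] the noise is independent of [X], and (with [C] the whole space) it
    keeps its law under [P]. *)
Hypothesis indep : forall A C, measurable A -> measurable C ->
  (mu (eps @^-1` A `&` X @^-1` C) = P (eps @^-1` A) * mu (X @^-1` C))%E.
Hypothesis eps_mean : ('E_P[eps] = 0)%E.
Hypothesis eps_var : ('V_P[eps] = sigma2%:E)%E.
Hypothesis X_sqr : forall j,
  mu.-integrable setT (EFin \o (fun w => tnth (X w) j ^+ 2)).

Let mX j : measurable_fun setT (fun w => tnth (X w) j).
Proof. exact: (measurableT_comp (measurable_tnth j)). Qed.

Let lin (x : d.-tuple R) : R := \sum_j slopes b j 0 * tnth x j.

Let mlin : measurable_fun setT lin.
Proof.
apply: measurable_sum => j; apply: measurable_funM => //.
exact: measurable_tnth.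
Qed.

Let linE x : dot (slopes b) (vec x) = lin x.
Proof. by rewrite dotE; apply: eq_bigr => j _; rewrite [vec _ _ _]mxE. Qed.

Let iX j : mu.-integrable setT (EFin \o (fun w => tnth (X w) j)).
Proof. exact: integrable_sqr. Qed.

Let iXX i j : mu.-integrable setT (EFin \o (fun w => tnth (X w) i * tnth (X w) j)).
Proof. exact: integrableM_sqr. Qed.

Let ilin : mu.-integrable setT (EFin \o (lin \o X)).
Proof. by apply: integrable_sumR => j; exact: integrableZR. Qed.

Let lin_sqrE x : lin x ^+ 2 =
  \sum_i slopes b i 0 * \sum_j slopes b j 0 * (tnth x i * tnth x j).
Proof.
rewrite expr2 {1}/lin mulr_suml; apply: eq_bigr => i _.
rewrite -mulrA; congr (_ * _); rewrite mulr_sumr; apply: eq_bigr => j _.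
by rewrite mulrCA.
Qed.

Let ilin2 : mu.-integrable setT (EFin \o (fun w => lin (X w) ^+ 2)).
Proof.
under [X in EFin \o X]eq_fun do rewrite lin_sqrE.
apply: integrable_sumR => i; apply: integrableZR.
by apply: integrable_sumR => j; exact: integrableZR.
Qed.

Let eps2 : (\int[P]_w (eps w ^+ 2)%:E = sigma2%:E)%E.
Proof.
rewrite -eps_var /variance covariance.unlock eps_mean/= expectation.unlock.
by apply: eq_integral => w _ /=; rewrite !fctE/= !subr0 expr2.
Qed.

Let ieps2 : P.-integrable setT (EFin \o (fun w => eps w ^+ 2)).
Proof.
by apply: integrable_sqr_lty => //; rewrite expectation.unlock eps2 ltry.
Qed.

Let ieps : P.-integrable setT (EFin \o eps).
Proof. exact: integrable_sqr. Qed.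

Let law_integrable d' (T' : measurableType d') (m : probability Omega R)
  (Z : {mfun Omega >-> T'}) (h : T' -> R) : measurable_fun setT h ->
  m.-integrable setT (EFin \o (fun w => h (Z w))) ->
  (distribution m Z).-integrable setT (EFin \o h).
Proof.
move=> mh hi; apply: integrable_pushforward => //.
exact/measurable_EFinP.
Qed.

Let law_Rintegral d' (T' : measurableType d') (m : probability Omega R)
  (Z : {mfun Omega >-> T'}) (h : T' -> R) : measurable_fun setT h ->
  m.-integrable setT (EFin \o (fun w => h (Z w))) ->
  \int[distribution m Z]_y h y = \int[m]_w h (Z w).
Proof.
move=> mh hi; rewrite /Rintegral integral_distribution//.
exact/measurable_EFinP.
Qed.

(** The product rule for the law of the noise under [P] and the law of [X] under [mu]. *)
Let Rintegral_epsM (h1 : R -> R) (h2 : d.-tuple R -> R) :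
  measurable_fun setT h1 -> measurable_fun setT h2 ->
  P.-integrable setT (EFin \o (fun w => h1 (eps w))) ->
  mu.-integrable setT (EFin \o (fun w => h2 (X w))) ->
  mu.-integrable setT (EFin \o (fun w => h1 (eps w) * h2 (X w))) /\
  \int[mu]_w (h1 (eps w) * h2 (X w)) =
    (\int[P]_w h1 (eps w)) * \int[mu]_w h2 (X w).
Proof.
move=> mh1 mh2 i1 i2.
have i1' := law_integrable mh1 i1.
have i2' := law_integrable mh2 i2.
have indep' A C : measurable A -> measurable C ->
    (mu (eps @^-1` A `&` X @^-1` C) =
     distribution P eps A * distribution mu X C)%E := @indep A C.
split; first exact: (integrable_indepM _ _ indep' i1' i2').
by rewrite (Rintegral_indepM _ _ indep' i1' i2')// !law_Rintegral.
Qed.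

(** The constant 1 as function of [X] carries moments of the noise from [P] over to [mu]. *)
Let Rintegral_eps1 (h1 : R -> R) : measurable_fun setT h1 ->
  P.-integrable setT (EFin \o (fun w => h1 (eps w))) ->
  mu.-integrable setT (EFin \o (fun w => h1 (eps w))) /\
  \int[mu]_w h1 (eps w) = \int[P]_w h1 (eps w).
Proof.
move=> mh1 i1.
have i2 : mu.-integrable setT (EFin \o (fun w => (cst 1 : _ -> R) (X w))).
  exact: finite_measure_integrable_cst.
have mc : measurable_fun setT (cst 1 : d.-tuple R -> R) by exact: measurable_cst.
have [] := Rintegral_epsM mh1 mc i1 i2.
under [X in EFin \o X]eq_fun do rewrite mulr1.
under eq_Rintegral do rewrite mulr1.
by rewrite Rintegral_probability_cst mulr1.
Qed.

Let mid : measurable_fun setT (fun x : R => x).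
Proof. exact: measurable_id. Qed.

Let mid2 : measurable_fun setT (fun x : R => x ^+ 2).
Proof. exact: measurable_funX. Qed.

Let epsmu : mu.-integrable setT (EFin \o eps) /\ \int[mu]_w eps w = 0.
Proof.
have [i ->] := Rintegral_eps1 mid ieps; split => //.
by move: eps_mean; rewrite expectation.unlock /Rintegral => ->.
Qed.

Let eps2mu : mu.-integrable setT (EFin \o (fun w => eps w ^+ 2)) /\
  \int[mu]_w (eps w ^+ 2) = sigma2.
Proof.
have [i ->] := Rintegral_eps1 mid2 ieps2.
by split => //; rewrite /Rintegral eps2.
Qed.

Let epslin : mu.-integrable setT (EFin \o (fun w => eps w * lin (X w))) /\
  \int[mu]_w (eps w * lin (X w)) = 0.
Proof.
have [i ->] := Rintegral_epsM mid mlin ieps ilin; split => //.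
by move: eps_mean; rewrite expectation.unlock /Rintegral => ->; rewrite mul0r.
Qed.

Let m := (\col_j \int[mu]_w tnth (X w) j : 'cV[R]_d).
Let C := (\matrix_(i, j) (\int[mu]_w (tnth (X w) i * tnth (X w) j)
  - m i 0 * m j 0) : 'M[R]_d).

Let mean_lin : \int[mu]_w lin (X w) = dot (slopes b) m.
Proof.
rewrite Rintegral_sum => [|j]; last exact: integrableZR.
by rewrite dotE; apply: eq_bigr => j _; rewrite RintegralZl// [m _ _]mxE.
Qed.

(** Bilinear expansion; it serves both for the variance of the response and for the sign of the
    quadratic form. *)
Let var_lin : dot (slopes b) (C *m slopes b) =
  \int[mu]_w (lin (X w) ^+ 2) - (\int[mu]_w lin (X w)) ^+ 2.
Proof.
rewrite mean_lin; under [in RHS]eq_Rintegral do rewrite lin_sqrE.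
rewrite Rintegral_sum => [|i]; last first.
  by apply: integrableZR; apply: integrable_sumR => j; exact: integrableZR.
rewrite dot_quadE dotE expr2 mulr_suml -sumrB; apply: eq_bigr => i _.
rewrite RintegralZl//; last first.
  by apply: integrable_sumR => j; exact: integrableZR.
rewrite -mulrA -mulrBr; congr (_ * _).
rewrite Rintegral_sum => [|j]; last exact: integrableZR.
rewrite mulr_sumr -sumrB; apply: eq_bigr => j _.
rewrite RintegralZl// [C _ _]mxE; ring.
Qed.

Lemma model_mean : \int[mu]_w Y w = b ord0 0 + dot (slopes b) m.
Proof.
have ci : mu.-integrable setT (EFin \o (cst (b ord0 0) : Omega -> R)).
  exact: finite_measure_integrable_cst.
have [ei e0] := epsmu.
rewrite (eq_ae_Rintegral (g := fun w => b ord0 0 + lin (X w) + eps w))//.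
- rewrite RintegralD//; last exact: (integrableDR ci ilin).
  by rewrite RintegralD// e0 Rintegral_probability_cst mean_lin addr0.
- apply: measurable_funD => //; apply: measurable_funD => //.
  exact: measurableT_comp.
- by apply: filterS model => w ->; rewrite linE.
Qed.

Lemma model_variance : \int[mu]_w (Y w ^+ 2) - (\int[mu]_w Y w) ^+ 2 =
  dot (slopes b) (C *m slopes b) + sigma2.
Proof.
set b0 := b ord0 0.
have ci : mu.-integrable setT (EFin \o (cst (b0 ^+ 2) : Omega -> R)).
  exact: finite_measure_integrable_cst.
have [ei e0] := epsmu; have [e2i e2] := eps2mu; have [eli el] := epslin.
have mlX : measurable_fun setT (lin \o X) by exact: measurableT_comp.
rewrite model_mean var_lin mean_lin -/b0.
(* The square of the model equation has six monomials. They are added step by step so that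
   integrability accumulates; the two that are linear in the noise integrate to 0. *)
pose t1 w := b0 ^+ 2 + (2 * b0) * lin (X w).
pose t2 w := t1 w + lin (X w) ^+ 2.
pose t3 w := t2 w + (2 * b0) * eps w.
pose t4 w := t3 w + 2 * (eps w * lin (X w)).
have i1 : mu.-integrable setT (EFin \o t1).
  exact: (integrableDR ci (integrableZR (2 * b0) ilin)).
have i2 : mu.-integrable setT (EFin \o t2) by exact: (integrableDR i1 ilin2).
have i3 : mu.-integrable setT (EFin \o t3).
  exact: (integrableDR i2 (integrableZR (2 * b0) ei)).
have i4 : mu.-integrable setT (EFin \o t4).
  exact: (integrableDR i3 (integrableZR 2 eli)).
rewrite (eq_ae_Rintegral (g := fun w => t4 w + eps w ^+ 2)); last 3 first.
- exact: measurable_funX.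
- exact/measurable_EFinP/(measurable_int mu)/(integrableDR i4 e2i).
- apply: filterS model => w ->; rewrite linE /t4 /t3 /t2 /t1 -/b0; ring.
rewrite RintegralD// e2 RintegralD//; last exact: (integrableZR 2 eli).
rewrite RintegralZl// el RintegralD//; last exact: (integrableZR _ ei).
rewrite RintegralZl// e0 RintegralD// RintegralD//; last exact: (integrableZR _ ilin).
rewrite Rintegral_probability_cst RintegralZl// mean_lin; ring.
Qed.

Lemma model_quad_ge0 : 0 <= dot (slopes b) (C *m slopes b).
Proof.
rewrite var_lin; apply: variance_ge0_Rintegral => //.
exact: measurableT_comp.
Qed.

End linear_model_moments.

(** * Sampling from conditional laws *)

Section conditional_sampling.
Context d d' (T : measurableType d) (T' : measurableType d') (R : realType).
Context (P : probability T R) (B : set T) (mB : measurable B).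
Hypothesis PB : (0 < P B)%E.
Context (Z : {mfun T >-> T'}).
Context dQ (TQ : measurableType dQ) (Q : probability TQ R).

(** The sampled law is the law of [Z] under the probability [conditional P mB], to which the weak
    law applies. *)
Lemma weak_law_cond (n : nat -> nat) (S : forall m, 'I_(n m) -> TQ -> T')
    (f : T' -> R) :
  (forall m i, measurable_fun setT (@S m i)) ->
  (forall m, iid_sample Q (@S m) (fun A => cond_prob P B (Z @^-1` A))) ->
  n @ \oo --> \oo ->
  measurable_fun setT f ->
  P.-integrable setT (EFin \o (fun w => f (Z w))) ->
  (n p.1)%:R^-1 * \sum_i f (S p.1 i p.2) @[p --> in_probability Q]
    --> cond_expect P B (fun w => f (Z w)).
Proof.
move=> mS iidS noo mf fi.
pose mu := distribution (conditional P mB) Z.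
have iidmu m : iid_sample Q (@S m) mu.
  have [ind law] := iidS m; split=> // i A mA.
  by rewrite (law i A mA) -(conditionalE mB PB).
have fci : (conditional P mB).-integrable setT (EFin \o (fun w => f (Z w))).
  exact: integrable_conditional.
have fmu : mu.-integrable setT (EFin \o f).
  by apply: integrable_pushforward => //; exact/measurable_EFinP.
rewrite -(Rintegral_conditional mB)//.
have -> : \int[conditional P mB]_w f (Z w) = \int[mu]_y f y.
  by rewrite /Rintegral integral_distribution//; exact/measurable_EFinP.
exact: weak_law.
Qed.

End conditional_sampling.

(** The event that [X] is in [C] and [G = k] belongs to the sigma-algebra of the pair, so the noise
    is independent of it; division by the probability of [G = k] gives the claim. *)
Lemma cond_indep dO (Omega : measurableType dO) (R : realType)
    (P : probability Omega R) (d K : nat) (X : {RV P >-> d.-tuple R})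
    (G : Omega -> 'I_K) (eps : {RV P >-> R}) (k : 'I_K)
    (mG : measurable (G @^-1` [set k])) :
  (0 < P (G @^-1` [set k]))%E ->
  indep_systems P (sigma_of eps) (sigma_pair X G) ->
  forall A C, measurable A -> measurable C ->
  (conditional P mG (eps @^-1` A `&` X @^-1` C) =
   P (eps @^-1` A) * conditional P mG (X @^-1` C))%E.
Proof.
move=> G0 ind A C mA mC.
rewrite !conditionalE// /cond_prob -setIA ind ?muleA//.
  by exists A => //; rewrite setTI.
pose H := sigma_of X `|` preimage_set_system setT G discrete_measurable.
have [_ _ _ HI] := (sigma_algebraP (fun _ _ => @subsetT _ _)).1
  (smallest_sigma_algebra setT H).
apply: HI; apply: sub_sigma_algebra.
  by left; exists C => //; rewrite setTI.
by right; exists [set k] => //; rewrite setTI.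
Qed.

(** Both norms are maxima over coordinates; this serves to describe deviation events
    coordinatewise. *)
Lemma normr_col_pairE (R : realType) (d : nat) (u v : 'cV[R]_d) (s t e : R) :
  0 < e ->
  e <= `|(u, s) - (v, t) : 'cV[R]_d * R| <->
  (exists j, e <= `|u j 0 - v j 0|) \/ e <= `|s - t|.
Proof.
move=> e0; rewrite leNgt; split=> [/negP h|].
- apply: contrapT => /not_orP[/forallNP h1 h2]; apply: h.
  rewrite prod_normE/= gt_max; apply/andP; split; last first.
    by rewrite ltNge; apply/negP.
  rewrite /Num.norm/= mx_normrE; apply/bigmax_ltP; split => // -[i j] _ /=.
  by rewrite ord1 !mxE ltNge; apply/negP; exact: h1.
- move=> h; apply/negP; rewrite prod_normE/= gt_max => /andP[h1 h2].
  case: h => [[j]|]; last by rewrite leNgt h2.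
  rewrite leNgt => /negP; apply; move: h1.
  rewrite {1}/Num.norm/= mx_normrE => /bigmax_ltP[_ /(_ (j, 0) isT)].
  by rewrite !mxE.
Qed.

Lemma n_min_le K (ny nx : 'I_K -> nat) k :
  (n_min ny nx <= ny k)%N /\ (n_min ny nx <= nx k)%N.
Proof.
have le_bigminn s x0 (f : 'I_K -> nat) :
    k \in s -> (\big[minn/x0]_(i <- s) f i <= f k)%N.
  elim: s => // i s IH; rewrite inE big_cons => /orP[/eqP <-|/IH h].
    exact: geq_minl.
  exact: leq_trans (geq_minr _ _) h.
have := le_bigminn _ (\max_(k < K) maxn (ny k) (nx k))%N
  (fun k => minn (ny k) (nx k)) (mem_index_enum k).
rewrite -/(n_min ny nx) => h.
by split; apply: (leq_trans h); [exact: geq_minl|exact: geq_minr].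
Qed.

Lemma leq_cvg_infty (u v : nat -> nat) : (forall m, (u m <= v m)%N) ->
  u @ \oo --> \oo -> v @ \oo --> \oo.
Proof.
move=> uv uoo A [N _ NA].
suff : \forall m \near \oo, A (v m) by [].
near=> m; apply: NA; apply: leq_trans (uv m).
by near: m; exact: (uoo _ (nbhs_infty_ge N)).
Unshelve. all: by end_near. Qed.

(** The way back from the filter: the deviation events lie inside exceptional sets of vanishing
    probability. *)
Lemma in_probability_cvg d (T : measurableType d) (R : realType)
    (Q : probability T R) (n : nat) (u : nat -> 'I_n -> T -> R)
    (s : nat -> T -> R) (v : 'cV[R]_n) (t : R) :
  (forall m j, measurable_fun setT (u m j)) ->
  (forall m, measurable_fun setT (s m)) ->
  (\col_j u p.1 j p.2, s p.1 p.2) @[p --> in_probability Q] -->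
    ((v, t) : 'cV[R]_n * R) ->
  cvg_in_probability Q (fun m w => (\col_j u m j w, s m w) : 'cV[R]_n * R) (v, t).
Proof.
move=> mu ms /cvgrPdist_lt uv e e0.
have [B [mB uB B0]] := uv e e0.
apply: (squeeze_cvge _ _ B0); last exact: cvg_cst.
apply: nearW => m; rewrite measure_ge0/=.
apply: le_measure; rewrite ?inE//; last first.
  move=> w /= euv; apply: uB => /=; apply/negP.
  by rewrite -leNgt distrC.
(* A finite union of coordinate events, hence measurable, as monotonicity of [Q] requires. *)
rewrite (_ : [set w | _] = (\bigcup_(j in [set: 'I_n]) [set w | e <= `|u m j w - v j 0|])
    `|` [set w | e <= `|s m w - t|]).
  apply: measurableU.
    apply: fin_bigcup_measurable => // j _.
    rewrite -[X in measurable X]setTI; apply: measurable_fun_le => //.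
    by apply: measurableT_comp => //; exact: measurable_funB.
  rewrite -[X in measurable X]setTI; apply: measurable_fun_le => //.
  by apply: measurableT_comp => //; exact: measurable_funB.
apply/seteqP; split=> w /=.
  move=> /(normr_col_pairE _ _ _ _ e0)[[j]|h]; last by right.
  by rewrite mxE => h; left; exists j.
move=> h; apply/(normr_col_pairE _ _ _ _ e0).
case: h => [[j _ /= h]|h]; last by right.
by left; exists j; rewrite mxE.
Qed.

(** * Consistency of the optimal transport estimator *)

Theorem lemma4p2 (R : realType) (d K : nat)
  (dO : measure_display) (Omega : measurableType dO) (P : probability Omega R)
  (Y : {RV P >-> R}) (X : {RV P >-> d.-tuple R}) (G : Omega -> 'I_K)
  (eps : {RV P >-> R}) (beta : 'cV[R]_d.+1) (sigma2 : R)
  (mG : forall k, measurable (G @^-1` [set k]))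
  (G_gt0 : forall k, (0 < P (G @^-1` [set k]))%E)
  (Y_L2 : ('E_P[(fun w => Y w ^+ 2)%R] < +oo)%E)
  (X_L2 : ('E_P[(fun w => \sum_j tnth (X w) j ^+ 2)%R] < +oo)%E)
  (model : linear_model Y X G eps beta sigma2)
  (Theta : set ('cV[R]_d.+1 * R))
  (Theta_compact : compact Theta)
  (Theta_ge0 : forall p, Theta p -> 0 <= p.2)
  (Theta_neq0 : ~ Theta (0, 0))
  (Theta_true : Theta (beta, sigma2))
  (rank_mu : \rank (mu1X X G) = d.+1)
  (pi_ : 'I_K -> R) (pi_gt0 : forall k, 0 < pi_ k) (pi_sum : \sum_k pi_ k = 1)
  (dO' : measure_display) (Omega' : measurableType dO') (Q : probability Omega' R)
  (ny nx : nat -> 'I_K -> nat)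
  (Ys : forall m k, 'I_(ny m k) -> {RV Q >-> R})
  (Xs : forall m k, 'I_(nx m k) -> {RV Q >-> d.-tuple R})
  (data : forall m, two_sample_data Y X G (Ys m) (Xs m))
  (n_min_oo : (fun m => n_min (ny m) (nx m)) @ \oo --> \oo)
  (betaW : nat -> 'I_d.+1 -> {RV Q >-> R}) (sigma2W : nat -> {RV Q >-> R})
  (estimator : forall m w,
     minimizes_over Theta
       (phi pi_ (fun k i => Ys m k i w) (fun k i => Xs m k i w))
       (\col_j betaW m j w, sigma2W m w)) :
  cvg_in_probability Q
    (fun m w => (\col_j betaW m j w, sigma2W m w) : 'cV[R]_d.+1 * R)
    (beta, sigma2).
Proof.
pose F := in_probability Q.
pose B k := G @^-1` [set k]; pose E k f := cond_expect P (B k) f.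
pose mu k := conditional P (mG k).
(* Without groups the weights would sum to 0 instead of 1. *)
have K0 : (0 < K)%N.
  rewrite lt0n; apply/eqP => K0; move/eqP: pi_sum.
  rewrite big1 ?(eq_sym 0) ?oner_eq0// => k _.
  by have := ltn_ord k; rewrite [X in (_ < X)%N]K0.
have [modelP ind eps_mean eps_var] := model.
have mY : measurable_fun setT Y by [].
have mX j : measurable_fun setT (fun w => tnth (X w) j).
  exact: (measurableT_comp (measurable_tnth j)).
have iY2 : P.-integrable setT (EFin \o (fun w => Y w ^+ 2)).
  exact: integrable_sqr_lty.
have iY : P.-integrable setT (EFin \o Y) by exact: integrable_sqr.
(* Each squared coordinate is dominated by the squared Euclidean norm, whose expectation is
   finite. *)
have iX2 j : P.-integrable setT (EFin \o (fun w => tnth (X w) j ^+ 2)).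
  apply: (@integrable_le _ _ _ _ _ (fun w => \sum_j tnth (X w) j ^+ 2)).
  - exact: measurable_funX.
  - have mS : measurable_fun setT (fun w => \sum_j tnth (X w) j ^+ 2).
      by apply: measurable_sum => i; exact: measurable_funX.
    apply/integrableP; split; first exact/measurable_EFinP.
    have S0 w : 0 <= \sum_j tnth (X w) j ^+ 2.
      by apply: sumr_ge0 => i _; exact: sqr_ge0.
    move: X_L2; rewrite expectation.unlock; apply: le_lt_trans.
    rewrite le_eqVlt; apply/orP; left; apply/eqP; apply: eq_integral => w _.
    by rewrite /= ger0_norm.
  - move=> w; rewrite ger0_norm ?sqr_ge0// (bigD1 j)//= lerDl.
    by apply: sumr_ge0 => i _; exact: sqr_ge0.
have iX j : P.-integrable setT (EFin \o (fun w => tnth (X w) j)).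
  exact: integrable_sqr.
have iXX i j : P.-integrable setT (EFin \o (fun w => tnth (X w) i * tnth (X w) j)).
  exact: integrableM_sqr.
have muE k f : P.-integrable setT (EFin \o f) -> \int[mu k]_w f w = E k f.
  by move=> fi; rewrite Rintegral_conditional.
(* Group moments of the population: the limits of the sample moments. *)
pose mY0 k := E k Y; pose vY0 k := E k (fun w => Y w ^+ 2) - mY0 k ^+ 2.
pose mX0 k := cond_mean_X X G k.
pose CX0 k : 'M[R]_d := \matrix_(i, j)
  (E k (fun w => tnth (X w) i * tnth (X w) j) - mX0 k i 0 * mX0 k j 0).
have modelk k : {ae mu k, forall w,
    Y w = beta ord0 0 + dot (slopes beta) (vec (X w)) + eps w}.
  exact: ae_conditional.
have indk k := cond_indep (mG k) (G_gt0 k) ind.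
have iX2k k j : (mu k).-integrable setT (EFin \o (fun w => tnth (X w) j ^+ 2)).
  exact: integrable_conditional.
(* These identities translate integrals against [mu k], in which the model moments are computed,
   into conditional expectations. *)
have mX0E k : \col_j \int[mu k]_w tnth (X w) j = mX0 k.
  by apply/matrixP => j z; rewrite !mxE muE.
have CX0E k : \matrix_(i, j) (\int[mu k]_w (tnth (X w) i * tnth (X w) j)
    - (\col_j \int[mu k]_w tnth (X w) j) i 0
      * (\col_j \int[mu k]_w tnth (X w) j) j 0) = CX0 k.
  by apply/matrixP => i j; rewrite mX0E !mxE muE.
have pop_mean k : mY0 k = beta ord0 0 + dot (slopes beta) (mX0 k).
  rewrite -mX0E /mY0 -muE//.
  exact: (model_mean (modelk k) (indk k) eps_mean eps_var (iX2k k)).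
have pop_var k : vY0 k = dot (slopes beta) (CX0 k *m slopes beta) + sigma2.
  rewrite -CX0E /vY0 /mY0 -!muE//.
  exact: (model_variance (modelk k) (indk k) eps_mean eps_var (iX2k k)).
have pop_ge0 k : 0 <= dot (slopes beta) (CX0 k *m slopes beta).
  by rewrite -CX0E; exact: model_quad_ge0 (iX2k k).
have noo k : (fun m => ny m k) @ \oo --> \oo /\ (fun m => nx m k) @ \oo --> \oo.
  split; apply: (leq_cvg_infty _ n_min_oo) => m.
    by have [] := n_min_le (ny m) (nx m) k.
  by have [] := n_min_le (ny m) (nx m) k.
(* Used with the identity and the square for [Y], and below with coordinates and their products for
   [X]; the sample moments are polynomials in these averages. *)
have wllnY k (f : R -> R) : measurable_fun setT f ->
    P.-integrable setT (EFin \o (fun w => f (Y w))) ->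
    (ny p.1 k)%:R^-1 * \sum_i f (Ys p.1 k i p.2) @[p --> F]
      --> E k (fun w => f (Y w)).
  move=> mf fi; apply: (weak_law_cond (mG k) (G_gt0 k)
    (S := fun m i => Ys m k i)) => //.
  - by move=> m; have [/(_ k)] := data m.
  - by have [] := noo k.
have wllnX k (f : d.-tuple R -> R) : measurable_fun setT f ->
    P.-integrable setT (EFin \o (fun w => f (X w))) ->
    (nx p.1 k)%:R^-1 * \sum_i f (Xs p.1 k i p.2) @[p --> F]
      --> E k (fun w => f (X w)).
  move=> mf fi; apply: (weak_law_cond (mG k) (G_gt0 k)
    (S := fun m i => Xs m k i)) => //.
  - by move=> m; have [_ /(_ k)] := data m.
  - by have [] := noo k.
pose ys (p : nat * Omega') k (i : 'I_(ny p.1 k)) := Ys p.1 k i p.2.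
pose xs (p : nat * Omega') k (i : 'I_(nx p.1 k)) := Xs p.1 k i p.2.
have cmY k : mean_Y (@ys p k) @[p --> F] --> mY0 k.
  exact: (wllnY k _ (@measurable_id _ _ setT) iY).
have cvY k : var_Y (@ys p k) @[p --> F] --> vY0 k.
  apply: cvgB; last by apply: cvgM; exact: cmY.
  have msqr : measurable_fun setT (fun y : R => y ^+ 2).
    exact: measurable_funX.
  exact: (wllnY k _ msqr iY2).
have mtnth (j : 'I_d) : measurable_fun setT (fun x : d.-tuple R => tnth x j).
  exact: measurable_tnth.
have mean_XE (p : nat * Omega') k j : mean_X (@xs p k) j 0 =
    (nx p.1 k)%:R^-1 * \sum_i tnth (Xs p.1 k i p.2) j.
  by rewrite mxE summxE; congr (_ * _); apply: eq_bigr => i _; rewrite mxE.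
have cmX k j : mean_X (@xs p k) j 0 @[p --> F] --> mX0 k j 0.
  under eq_fun do rewrite mean_XE.
  rewrite mxE; exact: (wllnX k _ (mtnth j) (iX j)).
have cCX k i j : cov_X (@xs p k) i j @[p --> F] --> CX0 k i j.
  have cov_XE (p : nat * Omega') : cov_X (@xs p k) i j =
      (nx p.1 k)%:R^-1 * \sum_l tnth (Xs p.1 k l p.2) i * tnth (Xs p.1 k l p.2) j
      - mean_X (@xs p k) i 0 * mean_X (@xs p k) j 0.
    rewrite /cov_X; move: (mean_X _) => M.
    rewrite !mxE big_ord1 mxE summxE; congr (_ * _ - _).
    by apply: eq_bigr => l _; rewrite !mxE big_ord1 !mxE.
  under eq_fun do rewrite cov_XE.
  rewrite [CX0 _ _ _]mxE; apply: cvgB; last by apply: cvgM; exact: cmX.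
  exact: (wllnX k _ (measurable_funM (mtnth i) (mtnth j)) (iXX i j)).
pose L p := phi pi_ (@ys p) (@xs p).
pose L0 := loss pi_ mY0 vY0 mX0 CX0.
apply: in_probability_cvg => //.
apply: (@argmin_cvg _ _ _ F _ Theta L L0) => //.
(* [phi] is [loss] at the sample moments. These depend on the second component of the product filter
   alone, while the parameter is the first. *)
- move=> x _; apply: loss_cvg.
  + by move=> k; apply: (cvg_comp snd _ cvg_snd (cmY k)).
  + by move=> k; apply: (cvg_comp snd _ cvg_snd (cvY k)).
  + by move=> k j; apply: (cvg_comp snd _ cvg_snd (cmX k j)).
  + by move=> k i j; apply: (cvg_comp snd _ cvg_snd (cCX k i j)).
  + exact: cvg_fst.
- move=> x Tx xq; apply: loss_identifies => //.
  + exact: Theta_ge0 Theta_true.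
  + exact: Theta_ge0.
- by move=> [m w]; exact: estimator.
Qed.
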